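(* In order for a given linear functional $\Omega$, defined on $\mathbb{C}_{2N}[\lambda]$, to be the generalized spectral function for some real $N\times N$ Jacobi matrix $J$ (entries $a_n,b_n\in\mathbb{R}$, $a_n\ne0$), it is necessary and sufficient that $$D_0=1,\qquad D_n>0\quad(n=1,2,\dots,N-1),\qquad\text{and}\qquad D_N=0,$$ where $D_n=\det(s_{i+j})_{i,j=0}^{n}$ for $n=0,1,\dots,N$, with $s_l=\langle\Omega,\lambda^l\rangle$ for $l=0,1,\dots,2N$.
   Context: $N$ is a positive integer. A real Jacobi matrix $J$ here is an $N\times N$ symmetric tridiagonal matrix (rows and columns indexed $0,\dots,N-1$) with diagonal entries $b_0,\dots,b_{N-1}\in\mathbb{R}$, with nonzero entries $a_n\in\mathbb{R}$ in positions $(n,n+1)$ and $(n+1,n)$ for $0\le n\le N-2$, and zeros elsewhere. Put $a_{N-1}=1$. The polynomials $P_0(\lambda),\dots,P_N(\lambda)$ associated with $J$ are defined by $P_0(\lambda)=1$, $b_0P_0(\lambda)+a_0P_1(\lambda)=\lambda P_0(\lambda)$, $a_{n-1}P_{n-1}(\lambda)+b_nP_n(\lambda)+a_nP_{n+1}(\lambda)=\lambda P_n(\lambda)$ for $n\in\{1,\dots,N-1\}$. $\mathbb{C}_m[\lambda]$ is the space of polynomials in $\lambda$ of degree $\le m$ with complex coefficients; $\langle\Omega,G(\lambda)\rangle$ denotes the value of the linear functional $\Omega$ (complex-valued and complex-linear) at $G$. The generalized spectral function of $J$ is the unique linear functional $\Omega:\mathbb{C}_{2N}[\lambda]\to\mathbb{C}$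 such that $\langle\Omega,P_m(\lambda)P_n(\lambda)\rangle=\delta_{mn}$ (Kronecker delta) for $m,n\in\{0,\dots,N-1\}$ and $\langle\Omega,P_m(\lambda)P_N(\lambda)\rangle=0$ for $m\in\{0,\dots,N\}$.
   Formalization: The criterion gets the extra condition that all moments s_0,…,s_{2N} are real; without it sufficiency fails for complex-valued Ω (N=1, s_0=1, s_1=i, s_2=−1 gives D_0=1, D_1=0 but no real J). *)

(* Defs.v *)
From mathcomp Require Import all_boot all_order all_algebra.
From mathcomp Require Import reals complex zify.

Set Implicit Arguments.
Unset Strict Implicit.
Unset Printing Implicit Defensive.

Import Order.TTheory GRing.Theory Num.Theory.
Local Open Scope ring_scope.

Section JacobiMatrices.
Variables (F : fieldType) (N : nat).

Definition is_jacobi (J : 'M[F]_N) : Prop :=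
  [/\ J^T = J,
      forall i j : 'I_N, (i.+1 < j)%N -> J i j = 0
    & forall i j : 'I_N, j = i.+1 :> nat -> J i j != 0].

(* Entry of J at natural-number indices; the value 0 outside the matrix is
   never used at the indices occurring in the recurrence for P_0, ..., P_N. *)
Definition entry (J : 'M[F]_N) (i j : nat) : F :=
  match insub i : option 'I_N, insub j : option 'I_N with
  | Some i', Some j' => J i' j'
  | _, _ => 0
  end.

Definition jacobi_b (J : 'M[F]_N) (n : nat) : F := entry J n n.

(* The last coefficient a_(N-1) is not an entry of J: it is 1 by convention. *)
Definition jacobi_a (J : 'M[F]_N) (n : nat) : F :=
  if n.+1 == N then 1 else entry J n n.+1.

(* The pair (P_n, P_(n+1)), the three-term recurrence being solved for
   P_(n+1); see jacobi_poly0, jacobi_poly_rec0 and jacobi_poly_rec. *)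
Fixpoint jacobi_poly_pair (J : 'M[F]_N) (n : nat) : {poly F} * {poly F} :=
  if n is m.+1 then
    let: (p, q) := jacobi_poly_pair J m in
    (q, (jacobi_a J m.+1)^-1 *:
          (('X - (jacobi_b J m.+1)%:P) * q - jacobi_a J m *: p))
  else (1, (jacobi_a J 0)^-1 *: ('X - (jacobi_b J 0)%:P)).

Definition jacobi_poly (J : 'M[F]_N) (n : nat) : {poly F} :=
  (jacobi_poly_pair J n).1.

(* {poly_(2 * N).+1 F} is the space of polynomials of degree at most 2N;
   pairing truncates its polynomial argument to that space, which is harmless
   for the arguments considered (size_jacobi_polyM). *)
Definition pairing (Omega : {scalar {poly_(2 * N).+1 F}}) (G : {poly F}) : F :=
  Omega (npolyp (2 * N).+1 G).

Definition is_gen_spectral_function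
    (J : 'M[F]_N) (Omega : {scalar {poly_(2 * N).+1 F}}) : Prop :=
  (forall m n : nat, (m < N)%N -> (n < N)%N ->
     pairing Omega (jacobi_poly J m * jacobi_poly J n) = (m == n)%:R) /\
  (forall m : nat, (m <= N)%N ->
     pairing Omega (jacobi_poly J m * jacobi_poly J N) = 0).

Definition moment (Omega : {scalar {poly_(2 * N).+1 F}}) (l : nat) : F :=
  pairing Omega 'X^l.

Definition hankel_det (Omega : {scalar {poly_(2 * N).+1 F}}) (n : nat) : F :=
  \det (\matrix_(i < n.+1, j < n.+1) moment Omega (i + j)%N).

Lemma entry_ord (J : 'M[F]_N) (i j : 'I_N) : entry J i j = J i j.
Proof. by rewrite /entry !valK. Qed.

Lemma jacobi_a_neq0 (J : 'M[F]_N) (n : nat) :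
  is_jacobi J -> (n < N)%N -> jacobi_a J n != 0.
Proof.
move=> [_ _ Ja] ltnN; rewrite /jacobi_a; have [_|neN] := eqVneq n.+1 N.
  exact: oner_neq0.
have ltSnN : (n.+1 < N)%N by rewrite ltn_neqAle neN.
rewrite -[n.+1]/(val (Ordinal ltSnN)) -[n in entry _ n]/(val (Ordinal ltnN)).
by rewrite entry_ord; apply: Ja.
Qed.

Lemma jacobi_poly0 (J : 'M[F]_N) : jacobi_poly J 0 = 1.
Proof. by []. Qed.

Lemma jacobi_poly_rec0 (J : 'M[F]_N) : is_jacobi J -> (0 < N)%N ->
  jacobi_b J 0 *: jacobi_poly J 0 + jacobi_a J 0 *: jacobi_poly J 1
  = 'X * jacobi_poly J 0.
Proof.
move=> Jj N_gt0; rewrite /jacobi_poly /= scalerA divff ?jacobi_a_neq0 //.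
by rewrite scale1r alg_polyC mulr1 addrC subrK.
Qed.

Lemma jacobi_poly_rec (J : 'M[F]_N) (n : nat) :
  is_jacobi J -> (0 < n < N)%N ->
  jacobi_a J n.-1 *: jacobi_poly J n.-1 + jacobi_b J n *: jacobi_poly J n
    + jacobi_a J n *: jacobi_poly J n.+1
  = 'X * jacobi_poly J n.
Proof.
case: n => [|n] // Jj /= ltnN; rewrite /jacobi_poly /=.
case: (jacobi_poly_pair J n) => p q /=.
rewrite scalerA divff ?jacobi_a_neq0 // scale1r mulrBl mul_polyC.
by rewrite (addrC (_ *: p)) [LHS]addrC -[_ - _ - _]addrA -opprD subrK.
Qed.

Lemma size_jacobi_poly (J : 'M[F]_N) (n : nat) :
  is_jacobi J -> (n <= N)%N -> size (jacobi_poly J n) = n.+1.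
Proof.
move=> Jj; rewrite /jacobi_poly => lenN.
have sizeM (c : F) (q : {poly F}) k : c != 0 -> size q = k.+1 ->
    size (c^-1 *: (('X - (jacobi_b J k)%:P) * q)) = k.+2.
  move=> c0 sq; rewrite size_scale ?invr_eq0 // size_monicM ?monicXsubC //.
    by rewrite size_XsubC sq.
  by rewrite -size_poly_gt0 sq.
suff H k : (k < N)%N -> size (jacobi_poly_pair J k).1 = k.+1 /\
                        size (jacobi_poly_pair J k).2 = k.+2.
  case: n lenN => [_|n ltnN]; first by rewrite size_poly1.
  by have [_ <-] := H n ltnN; rewrite /=; case: (jacobi_poly_pair J n).
elim: k => [|k IHk] ltkN /=.
  split; first by rewrite size_poly1.
  by rewrite size_scale ?invr_eq0 ?jacobi_a_neq0 // size_XsubC.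
have [] := IHk (ltnW ltkN); case: (jacobi_poly_pair J k) => p q /= sp sq.
split=> //; rewrite scalerBr size_polyDl sizeM ?jacobi_a_neq0 //.
rewrite size_polyN scalerA (leq_ltn_trans (size_scale_leq _ _)) // sp.
exact: leqnSn.
Qed.

Lemma size_jacobi_polyM (J : 'M[F]_N) (m n : nat) :
  is_jacobi J -> (m <= N)%N -> (n <= N)%N ->
  size (jacobi_poly J m * jacobi_poly J n) = (m + n).+1.
Proof.
move=> Jj lemN lenN; have := size_jacobi_poly Jj lemN.
have := size_jacobi_poly Jj lenN => sn sm.
by rewrite size_mul -?size_poly_gt0 ?sm ?sn // addnS.
Qed.

Lemma gen_spectral_function_uniq (J : 'M[F]_N)
    (Omega Omega' : {scalar {poly_(2 * N).+1 F}}) :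
  is_jacobi J -> is_gen_spectral_function J Omega ->
  is_gen_spectral_function J Omega' -> Omega =1 Omega'.
Proof.
move=> Jj [Oo O0] [Oo' O0'].
have eqPM m n : (m <= n)%N -> (n <= N)%N ->
    pairing Omega (jacobi_poly J m * jacobi_poly J n)
    = pairing Omega' (jacobi_poly J m * jacobi_poly J n).
  move=> lemn; rewrite leq_eqVlt => /orP[/eqP eqnN|ltnN].
    by rewrite eqnN O0 ?O0' // -eqnN.
  by rewrite Oo ?Oo' // (leq_ltn_trans lemn).
suff H d (G : {poly F}) : (size G <= d)%N -> (d <= (2 * N).+1)%N ->
    pairing Omega G = pairing Omega' G.
  move=> G; have -> : G = npolyp (2 * N).+1 G.
    by apply/val_inj; rewrite /= npolypK ?size_npoly.
  exact: (H (2 * N).+1 G (size_npoly _)).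
elim: d G => [|d IHd] G sG led.
  move: sG; rewrite leqn0 size_poly_eq0 => /eqP->.
  have n0 : npolyp (2 * N).+1 (0 : {poly F}) = 0.
    by apply/val_inj; rewrite /= npolypK ?size_poly0.
  by rewrite /pairing n0 !raddf0.
have pairingB (O : {scalar {poly_(2 * N).+1 F}}) (c : F) (A B : {poly F}) :
    pairing O (c *: A + B) = c * pairing O A + pairing O B.
  rewrite /pairing.
  have <- : c *: npolyp (2 * N).+1 A + npolyp (2 * N).+1 B
            = npolyp (2 * N).+1 (c *: A + B).
    apply/npolyP => i.
    rewrite /= coefD coefZ !coef_npolyp.
    by rewrite coefD coefZ; case: ifP => // _; rewrite mulr0 addr0.
  by rewrite linearP.
pose m := (d - N)%N; pose n := minn d N.
have dmn : d = (m + n)%N by rewrite /m /n; case: (leqP d N); lia.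
have lenN : (n <= N)%N by exact: geq_minr.
have lemn : (m <= n)%N by rewrite /m /n; case: (leqP d N); lia.
set T := jacobi_poly J m * jacobi_poly J n.
have sT : size T = d.+1.
  by rewrite size_jacobi_polyM ?dmn // (leq_trans lemn).
have Td : T`_d != 0.
  by have := lead_coef_eq0 T; rewrite lead_coefE sT -size_poly_eq0 sT /= => ->.
pose c := G`_d / T`_d.
rewrite -(subrK (c *: T) G) addrC !pairingB eqPM //; congr (_ + _).
apply: IHd (ltnW led); apply/leq_sizeP => j; rewrite leq_eqVlt => /orP[/eqP<-|ltj].
  by rewrite coefB coefZ divfK // subrr.
by rewrite coefB coefZ !nth_default ?mulr0 ?subrr // ?sT // (leq_trans sG).
Qed.

End JacobiMatrices.

(* Main.v *)
(* Let C be the lower triangular matrix of coefficients of polynomials p_0, ...,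
   p_n with deg p_k = k. Then C H C^T is the Gram matrix <Omega, p_i p_j>, where
   H is the Hankel matrix of the moments. For the polynomials of a Jacobi matrix
   J this Gram matrix is the identity if n < N, and has a zero last row if n = N,
   which gives the signs of the D_n; since C is real and invertible, H is real.
   Conversely, the Stieltjes procedure builds orthonormal polynomials: the
   squared norm of the residual at step n is a positive multiple of D_(n+1), so
   it can be normalised until step N-1, where the residual is P_N itself. *)
From HB Require Import structures.
Require Import Defs.
From mathcomp Require Import all_boot all_order all_algebra.
From mathcomp Require Import reals complex zify.

Set Implicit Arguments.
Unset Strict Implicit.

Import Order.TTheory GRing.Theory Num.Theory.
Local Open Scope ring_scope.

(** * Gram and Hankel matrices of a linear functional, related by a triangular change of basis *)

Section GramMatrix.
Variable F : fieldType.
Implicit Types (L : {scalar {poly F}}) (p : nat -> {poly F}).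

Definition hankel_mx (L : {poly F} -> F) (n : nat) : 'M[F]_n.+1 :=
  \matrix_(i, j) L 'X^(i + j).

Definition gram_mx (L : {poly F} -> F) p (n : nat) : 'M[F]_n.+1 :=
  \matrix_(i, j) L (p i * p j).

Definition coef_mx p (n : nat) : 'M[F]_n.+1 := \matrix_(i, j) (p i)`_j.

Lemma gram_mxE L p n : (forall k, (k <= n)%N -> size (p k) = k.+1) ->
  gram_mx L p n = coef_mx p n *m hankel_mx L n *m (coef_mx p n)^T.
Proof.
move=> sp; apply/matrixP => i j; rewrite !mxE.
have pE (k : 'I_n.+1) : p k = \sum_(l < n.+1) (p k)`_l *: 'X^l.
  rewrite -[LHS](@take_poly_id _ n.+1) ?sp //; last by rewrite -ltnS.
  by rewrite [take_poly _ _]poly_def.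
rewrite {1}(pE i) {1}(pE j) mulr_sumr linear_sum /=; apply: eq_bigr => l _.
rewrite !mxE.
rewrite !mulr_suml linear_sum /=; apply: eq_bigr => k _.
by rewrite !mxE -scalerAl -scalerAr !linearZ /= -exprD mulrAC mulrA.
Qed.

Lemma det_coef_mx p n : (forall k, (k <= n)%N -> size (p k) = k.+1) ->
  \det (coef_mx p n) = \prod_(k < n.+1) lead_coef (p k).
Proof.
move=> sp; rewrite det_trig.
  by apply: eq_bigr => k _; rewrite mxE lead_coefE sp // -ltnS.
apply/is_trig_mxP => i j ltij; rewrite mxE nth_default // sp // -ltnS //.
Qed.

Lemma det_coef_mx_neq0 p n : (forall k, (k <= n)%N -> size (p k) = k.+1) ->
  \det (coef_mx p n) != 0.
Proof.
move=> sp; rewrite det_coef_mx //; apply/prodf_neq0 => k _.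
by rewrite lead_coef_eq0 -size_poly_eq0 sp // -ltnS.
Qed.

Lemma det_gram_mx L p n : (forall k, (k <= n)%N -> size (p k) = k.+1) ->
  \det (gram_mx L p n) = \det (coef_mx p n) ^+ 2 * \det (hankel_mx L n).
Proof. by move=> sp; rewrite gram_mxE // !det_mulmx det_tr mulrAC expr2. Qed.

(** This inverted form recovers the moments from the polynomials and their Gram matrix; it will show
    that the moments are real. *)
Lemma hankel_mxE L p n : (forall k, (k <= n)%N -> size (p k) = k.+1) ->
  hankel_mx L n
  = invmx (coef_mx p n) *m gram_mx L p n *m (invmx (coef_mx p n))^T.
Proof.
move=> sp; have Cu : coef_mx p n \in unitmx.
  by rewrite unitmxE unitfE det_coef_mx_neq0.
by rewrite gram_mxE // trmx_inv -!mulmxA mulmxV ?unitmx_tr // mulmx1 mulKmx.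
Qed.

End GramMatrix.

(** * The Stieltjes procedure over a real closed field *)

Section Stieltjes.
Variables (R : rcfType) (L : {scalar {poly R}}).

(* The pair (p_n, q_n) of the orthonormal polynomial of degree n and the
   residual q_n = (X - b_n) p_n - a_(n-1) p_(n-1), to be normalised into p_(n+1). *)
Fixpoint stieltjes (n : nat) : {poly R} * {poly R} :=
  if n is m.+1 then
    let: (p, q) := stieltjes m in
    let a := Num.sqrt (L (q * q)) in
    let p' := a^-1 *: q in
    (p', ('X - (L ('X * p' * p'))%:P) * p' - a *: p)
  else (1, 'X - (L 'X)%:P).

Let p n := (stieltjes n).1.
Let q n := (stieltjes n).2.
Definition stieltjes_a n := Num.sqrt (L ((stieltjes n).2 * (stieltjes n).2)).
Definition stieltjes_b n := L ('X * (stieltjes n).1 * (stieltjes n).1).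
Let a := stieltjes_a.
Let b := stieltjes_b.

Lemma stieltjesS n : stieltjes n.+1 =
  ((a n)^-1 *: q n, ('X - (b n.+1)%:P) * p n.+1 - a n *: p n).
Proof.
by rewrite /a /b /stieltjes_a /stieltjes_b /p /q /=; case: (stieltjes n).
Qed.

Lemma mulX_stieltjes0 : 'X * p 0 = q 0 + b 0 *: p 0.
Proof. by rewrite /b /stieltjes_b /p /q /= !mulr1 alg_polyC subrK. Qed.

Lemma mulX_stieltjesS n :
  'X * p n.+1 = q n.+1 + b n.+1 *: p n.+1 + a n *: p n.
Proof.
by rewrite [q n.+1]/q stieltjesS /= mulrBl mul_polyC addrAC subrK subrK.
Qed.

Lemma stieltjes_size n : (forall k, (k < n)%N -> a k != 0) ->
  size (p n) = n.+1 /\ size (q n) = n.+2.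
Proof.
elim: n => [|n IHn] a0; first by rewrite /p /q /= size_poly1 size_XsubC.
have [sp sq] := IHn (fun k ltkn => a0 k (ltnW ltkn)).
have spS : size (p n.+1) = n.+2.
  by rewrite [p n.+1]/p stieltjesS /= size_scale // invr_eq0 a0.
split=> //; rewrite [q n.+1]/q stieltjesS /=.
have sM : size (('X - (b n.+1)%:P) * p n.+1) = n.+3.
  by rewrite size_monicM ?monicXsubC ?size_XsubC ?spS // -size_poly_eq0 spS.
rewrite size_polyDl sM // size_polyN.
by rewrite (leq_ltn_trans (size_scale_leq _ _)) // sp.
Qed.

(** Multiplication by ['X] is symmetric for the form [L (f * g)], and ['X * p k] only involves [p]
    at [k.-1], [k], [k.+1]. Hence a residual orthogonal to the last two polynomials is orthogonal to
    all earlier ones. *)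
Lemma stieltjes_orthonormal n : L 1 = 1 -> (forall k, (k < n)%N -> 0 < a k) ->
  (forall j k, (j <= n)%N -> (k <= n)%N -> L (p j * p k) = (j == k)%:R) /\
  (forall k, (k <= n)%N -> L (q n * p k) = 0).
Proof.
move=> L1; elim: n => [|n IHn] a_gt0.
  split=> [j k|k]; rewrite !leqn0 => /eqP->.
    by move=> /eqP->; rewrite mulr1.
  by rewrite mulr1 linearB /= -alg_polyC linearZ /= L1 mulr1 subrr.
have [orthp orthq] := IHn (fun k ltkn => a_gt0 k (ltnW ltkn)).
have a_neq0 k : (k < n.+1)%N -> a k != 0 by move=> /a_gt0; rewrite lt0r => /andP[].
have pE k : p k.+1 = (a k)^-1 *: q k by rewrite /p stieltjesS.
have qE k : (k < n.+1)%N -> q k = a k *: p k.+1.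
  by move=> ltk; rewrite pE scalerA divff ?a_neq0 // scale1r.
have orthSn k : (k <= n)%N -> L (p n.+1 * p k) = 0.
  by move=> lekn; rewrite pE -scalerAl linearZ /= orthq // mulr0.
have normS : L (p n.+1 * p n.+1) = 1.
  have an_gt0 : 0 < a n by exact: a_gt0.
  have an2 : a n ^+ 2 = L (q n * q n).
    (* [Num.sqrt] is 0 on negative arguments, so [0 < a n] forces the radicand to be positive. *)
    by rewrite sqr_sqrtr // ltW // -sqrtr_gt0.
  rewrite pE -scalerAl -scalerAr !linearZ /= -an2 mulrA -invfM -expr2 mulVf //.
  by rewrite expf_neq0 // a_neq0.
have orthpS j k : (j <= n.+1)%N -> (k <= n.+1)%N -> L (p j * p k) = (j == k)%:R.
  rewrite leq_eqVlt ltnS => /predU1P[->|lejn];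
    rewrite leq_eqVlt ltnS => /predU1P[->|lekn].
  - by rewrite eqxx.
  - by rewrite orthSn // gtn_eqF.
  - by rewrite mulrC orthSn // ltn_eqF.
  - exact: orthp.
split=> // k; rewrite [q n.+1]/q stieltjesS /= leq_eqVlt ltnS.
have Lq r : L ((('X - (b n.+1)%:P) * p n.+1 - a n *: p n) * r)
    = L ('X * p n.+1 * r) - b n.+1 * L (p n.+1 * r) - a n * L (p n * r).
  by rewrite mulrBl mulrBl mul_polyC mulrBl -!scalerAl !linearB /= !linearZ.
rewrite Lq => /predU1P[->|lekn].
  by rewrite normS mulr1 subrr orthpS // ltn_eqF // mulr0 subr0.
rewrite orthSn // mulr0 subr0 orthp //.
have -> : 'X * p n.+1 * p k = p n.+1 * ('X * p k) by rewrite mulrAC mulrC.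
(* The only surviving term is at [k = n], where it cancels the subtracted [a n *: p n]. *)
suff -> : L (p n.+1 * ('X * p k)) = a k * (n.+1 == k.+1)%:R.
  by rewrite eqSS; case: eqVneq => [->|_]; rewrite ?mulr0 subrr.
have Lqk : L (p n.+1 * q k) = a k * (n.+1 == k.+1)%:R.
  by rewrite qE // -scalerAr linearZ /= orthpS.
case: k lekn Lqk {Lq} => [|k] lekn Lqk; rewrite (mulX_stieltjes0, mulX_stieltjesS).
  by rewrite mulrDr linearD /= Lqk -scalerAr linearZ /= orthSn // mulr0 addr0.
rewrite !mulrDr !linearD /= Lqk -!scalerAr !linearZ /= !orthSn ?mulr0 ?addr0 //.
exact: ltnW.
Qed.

(** The family [p 0], ..., [p n], [q n] has a diagonal Gram matrix whose determinant is the squared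
    norm of [q n]. The constant is the squared determinant of the coefficient matrix of this
    family. *)
Lemma stieltjes_residual_norm n :
  L 1 = 1 -> (forall k, (k < n)%N -> 0 < a k) ->
  exists2 c : R, 0 < c & L (q n * q n) = c * \det (hankel_mx L n.+1).
Proof.
move=> L1 a_gt0; have [orthp orthq] := stieltjes_orthonormal L1 a_gt0.
pose r k := if (k <= n)%N then p k else q n.
have sr k : (k <= n.+1)%N -> size (r k) = k.+1.
  have a0 m j : (m <= n)%N -> (j < m)%N -> a j != 0.
    by move=> lemn ltjm; rewrite lt0r_neq0 // a_gt0 // (leq_trans ltjm).
  rewrite /r; case: (leqP k n) => [lekn _|ltnk lekn].
    by have [] := @stieltjes_size k (fun j => a0 k j lekn).
  have -> : k = n.+1 by apply/eqP; rewrite eqn_leq lekn.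
  by have [] := @stieltjes_size n (fun j => a0 n j (leqnn n)).
exists (\det (coef_mx r n.+1) ^+ 2).
  by rewrite exprn_even_gt0 //= det_coef_mx_neq0.
rewrite -det_gram_mx //.
have -> : gram_mx L r n.+1
    = diag_mx (\row_j (if (j <= n)%N then 1 else L (q n * q n))).
  apply/matrixP => i j; rewrite !mxE /r.
  case: (leqP i n) => [lein|ltni]; case: (leqP j n) => [lejn|ltnj].
  - by rewrite orthp.
  - rewrite mulrC orthq //; case: eqP => // eqij; move: ltnj.
    by rewrite -eqij ltnNge lein.
  - rewrite orthq //; case: eqP => // eqij; move: ltni.
    by rewrite eqij ltnNge lejn.
  - suff -> : i = j by rewrite eqxx.
    by apply/val_inj; move: (ltn_ord i) (ltn_ord j) => /=; lia.
rewrite det_diag big_ord_recr /= mxE ltnn big1 ?mul1r // => i _.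
by rewrite mxE /= -ltnS ltn_ord.
Qed.

(** Strong induction: the norm formula for [q n] requires all earlier [a k] to be positive. The sign
    of [a n] is governed by the Hankel determinant of index [n.+1], hence the bound [n.+1 < N]. *)
Lemma stieltjes_a_gt0 N : L 1 = 1 ->
  (forall n, (0 < n < N)%N -> 0 < \det (hankel_mx L n)) ->
  forall n, (n.+1 < N)%N -> 0 < a n.
Proof.
move=> L1 D_gt0; elim/ltn_ind => n IHn ltnN.
have [|c c_gt0 qq] := @stieltjes_residual_norm n L1.
  by move=> k ltkn; apply: IHn => //; apply: leq_trans ltnN; rewrite ltnS ltnW.
by rewrite sqrtr_gt0 qq mulr_gt0 ?D_gt0.
Qed.

End Stieltjes.

(** * Jacobi matrices with prescribed coefficients and a finite Favard theorem *)

Section JacobiMatrixOfSequences.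
Variables (F : fieldType) (N : nat) (a b : nat -> F).

Definition tridiag_mx : 'M[F]_N :=
  \matrix_(i, j) (if i == j then b i else if j == i.+1 :> nat then a i
                  else if i == j.+1 :> nat then a j else 0).

Lemma tridiag_mx_jacobi :
  (forall n, (n.+1 < N)%N -> a n != 0) -> is_jacobi tridiag_mx.
Proof.
move=> a0; split=> [|i j ltij|i j eij].
- apply/matrixP => i j; rewrite !mxE; case: (eqVneq i j) => [->|_] //.
  by case: (i =P j.+1 :> nat) => [->|_]; first by rewrite ifF //; apply/eqP; lia.
- by rewrite mxE -val_eqE /= !ifF //; apply/eqP => /=; lia.
- rewrite mxE ifF ?eij ?eqxx; last by apply/eqP => eij'; move: eij; rewrite eij'; lia.
  by rewrite a0 // -eij.
Qed.

Lemma jacobi_b_tridiag n : (n < N)%N -> jacobi_b tridiag_mx n = b n.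
Proof.
move=> ltnN; rewrite /jacobi_b (entry_ord _ (Ordinal ltnN) (Ordinal ltnN)).
by rewrite mxE eqxx.
Qed.

Lemma jacobi_a_tridiag n :
  (n < N)%N -> jacobi_a tridiag_mx n = if n.+1 == N then 1 else a n.
Proof.
move=> ltnN; rewrite /jacobi_a; case: eqP => // /eqP neN.
have ltSnN : (n.+1 < N)%N by rewrite ltn_neqAle neN.
rewrite (entry_ord _ (Ordinal ltnN) (Ordinal ltSnN)) mxE -val_eqE /= eqxx.
by rewrite ltn_eqF.
Qed.

End JacobiMatrixOfSequences.

Lemma jacobi_polyS (F : fieldType) (N : nat) (J : 'M[F]_N) n :
  jacobi_poly J n.+1 = (jacobi_poly_pair J n).2.
Proof. by rewrite /jacobi_poly /=; case: (jacobi_poly_pair J n). Qed.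

(** The factor in the second component is the Stieltjes normalisation when [n.+1 < N], but 1 when
    [n.+1 = N]. Working with pairs treats both cases at once and reaches the last polynomial. *)
Lemma jacobi_poly_stieltjes (R : rcfType) (L : {scalar {poly R}}) N n :
  let J := tridiag_mx N (stieltjes_a L) (stieltjes_b L) in (n < N)%N ->
  jacobi_poly_pair J n
  = ((stieltjes L n).1, (jacobi_a J n)^-1 *: (stieltjes L n).2).
Proof.
move=> J; elim: n => [|n IHn] ltnN.
  rewrite /= jacobi_b_tridiag //.
  by rewrite /stieltjes_b /= !mulr1.
rewrite [LHS]/= IHn ?(ltnW ltnN) // stieltjesS jacobi_b_tridiag //.
by rewrite [jacobi_a _ n]jacobi_a_tridiag ?(ltnW ltnN) // ltn_eqF // stieltjesS.
Qed.

Lemma favard_finite (R : rcfType) (L : {scalar {poly R}}) N :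
  (0 < N)%N -> L 1 = 1 ->
  (forall n, (0 < n < N)%N -> 0 < \det (hankel_mx L n)) ->
  \det (hankel_mx L N) = 0 ->
  exists J : 'M[R]_N,
  [/\ is_jacobi J,
      forall m n, (m < N)%N -> (n < N)%N ->
        L (jacobi_poly J m * jacobi_poly J n) = (m == n)%:R
    & forall m, (m <= N)%N -> L (jacobi_poly J m * jacobi_poly J N) = 0].
Proof.
case: N => // N _ L1 D_gt0 D0.
have a_gt0 := stieltjes_a_gt0 L1 D_gt0.
set J := tridiag_mx N.+1 (stieltjes_a L) (stieltjes_b L); exists J.
have PE n : (n < N.+1)%N -> jacobi_poly J n = (stieltjes L n).1.
  by move=> ltnN; rewrite /jacobi_poly jacobi_poly_stieltjes.
have PNE : jacobi_poly J N.+1 = (stieltjes L N).2.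
  rewrite jacobi_polyS jacobi_poly_stieltjes // jacobi_a_tridiag // eqxx.
  by rewrite invr1 scale1r.
have [orthp orthq] := stieltjes_orthonormal L1 a_gt0.
split=> [|m n ltmN ltnN|m].
- by apply: tridiag_mx_jacobi => n ltnN; rewrite lt0r_neq0 // a_gt0.
- by rewrite !PE // orthp.
- rewrite leq_eqVlt => /predU1P[->|ltmN].
    (* The squared norm of the last residual is a multiple of the vanishing determinant. *)
    by have [c _] := stieltjes_residual_norm L1 a_gt0; rewrite PNE D0 mulr0.
  by rewrite PNE PE // mulrC orthq.
Qed.

(** * The functional extended by truncation to all polynomials *)

Section Pairing.
Variables (F : fieldType) (N : nat) (Omega : {scalar {poly_(2 * N).+1 F}}).

Lemma pairing_is_scalar : scalar (pairing Omega).
Proof.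
move=> c A B; rewrite /pairing -linearP; congr (Omega _).
apply/npolyP => i; rewrite /= coefD coefZ !coef_npolyp coefD coefZ.
by case: ifP => // _; rewrite mulr0 addr0.
Qed.

HB.instance Definition _ :=
  GRing.isLinear.Build F {poly F} F *%R (pairing Omega) pairing_is_scalar.

Lemma pairing_Xn_over l : (2 * N < l)%N -> pairing Omega 'X^l = 0.
Proof.
move=> ltNl; rewrite /pairing.
suff -> : npolyp (2 * N).+1 ('X^l : {poly F}) = 0 by rewrite linear0.
apply/npolyP => i; rewrite /= coef_npolyp coef0 coefXn.
by case: ifP => // ltiN; rewrite ltn_eqF // (leq_trans ltiN).
Qed.

Lemma gram_mx_gen_spectral (J : 'M[F]_N) n : (n <= N)%N ->
  is_gen_spectral_function J Omega ->
  gram_mx (pairing Omega) (jacobi_poly J) n = diag_mx (\row_j (j < N)%:R).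
Proof.
move=> lenN [orth orthN]; apply/matrixP => i j; rewrite !mxE.
have [lei lej] : (i <= N)%N /\ (j <= N)%N.
  by split; apply: leq_trans lenN; rewrite -ltnS ltn_ord.
move: lei; rewrite leq_eqVlt => /predU1P[eiN|ltiN];
  move: lej; rewrite leq_eqVlt => /predU1P[ejN|ltjN].
- by rewrite eiN ejN orthN // ltnn mul0rn.
- by rewrite mulrC eiN orthN ?(ltnW ltjN) // ltnn mul0rn.
- by rewrite ejN orthN ?(ltnW ltiN) // -val_eqE /= ltn_eqF ?mulr0n ?ejN.
- by rewrite orth // ltiN.
Qed.

End Pairing.

(** * Descent from complex to real coefficients *)

Section RealToComplex.
Variables (R : rcfType) (N : nat).
Local Notation rc := (real_complex R).

Lemma map_jacobi (J : 'M[R]_N) : is_jacobi J -> is_jacobi (map_mx rc J).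
Proof.
move=> [JT J0 Jn0]; split=> [|i j ltij|i j eij].
- by rewrite map_trmx JT.
- by rewrite mxE J0 // rmorph0.
- by rewrite mxE fmorph_eq0 Jn0.
Qed.

Lemma entry_map (J : 'M[R]_N) i j : entry (map_mx rc J) i j = rc (entry J i j).
Proof.
rewrite /entry; case: insub => [i'|]; last by rewrite rmorph0.
by case: insub => [j'|]; rewrite ?mxE ?rmorph0.
Qed.

Lemma jacobi_a_map (J : 'M[R]_N) n : jacobi_a (map_mx rc J) n = rc (jacobi_a J n).
Proof. by rewrite /jacobi_a entry_map; case: ifP; rewrite ?rmorph1. Qed.

Lemma jacobi_b_map (J : 'M[R]_N) n : jacobi_b (map_mx rc J) n = rc (jacobi_b J n).
Proof. exact: entry_map. Qed.

Lemma jacobi_poly_map (J : 'M[R]_N) n :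
  jacobi_poly (map_mx rc J) n = map_poly rc (jacobi_poly J n).
Proof.
rewrite /jacobi_poly; suff -> : jacobi_poly_pair (map_mx rc J) n
    = (map_poly rc (jacobi_poly_pair J n).1, map_poly rc (jacobi_poly_pair J n).2).
  by [].
elim: n => [|n IHn] /=.
  rewrite map_polyZ fmorphV rmorph1 rmorphB /= map_polyX map_polyC /=.
  by rewrite jacobi_a_map jacobi_b_map.
rewrite IHn; case: (jacobi_poly_pair J n) => p q /=; congr pair.
rewrite map_polyZ fmorphV rmorphB rmorphM rmorphB /= map_polyX map_polyC map_polyZ.
by rewrite !jacobi_a_map jacobi_b_map.
Qed.

Variable Omega : {scalar {poly_(2 * N).+1 R[i]}}.

(** Taking the real part gives an [R]-linear functional without any assumption on [Omega]; it agrees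
    with [pairing Omega] on real polynomials once the moments are real. *)
Definition real_pairing (G : {poly R}) : R :=
  complex.Re (pairing Omega (map_poly rc G)).

Lemma real_pairing_is_scalar : scalar real_pairing.
Proof.
move=> c A B; rewrite /real_pairing rmorphD /= map_polyZ linearP /=.
by case: (pairing _ _) => x y; case: (pairing _ _) => z t /=; rewrite mul0r subr0.
Qed.

HB.instance Definition _ :=
  GRing.isLinear.Build R {poly R} R *%R real_pairing real_pairing_is_scalar.

Hypothesis moment_real :
  forall l : nat, (l <= 2 * N)%N -> moment Omega l \is Num.real.

Lemma pairing_map (G : {poly R}) :
  pairing Omega (map_poly rc G) = rc (real_pairing G).
Proof.
rewrite RRe_real // -[G]coefK poly_def rmorph_sum linear_sum /=.
apply: rpred_sum => i _; rewrite map_polyZ map_polyXn linearZ /=.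
apply: realM; first by apply/complex_realP; eexists.
have [lel|gtl] := leqP i (2 * N); first exact: moment_real.
by rewrite pairing_Xn_over.
Qed.

Lemma hankel_det_map n :
  hankel_det Omega n = rc (\det (hankel_mx real_pairing n)).
Proof.
rewrite -det_map_mx; congr (\det _); apply/matrixP => i j.
by rewrite !mxE /= -pairing_map map_polyXn.
Qed.

End RealToComplex.

(** * Consequences for the moments of having a real Jacobi matrix *)

Section Necessity.
Variables (R : rcfType) (N : nat) (Omega : {scalar {poly_(2 * N).+1 R[i]}}).
Variable J : 'M[R]_N.
Hypotheses (Jj : is_jacobi J)
  (specJ : is_gen_spectral_function (map_mx (real_complex R) J) Omega).
Local Notation rc := (real_complex R).
Local Notation C n := (coef_mx (jacobi_poly J) n).

Let size_P n : (n <= N)%N ->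
  forall k, (k <= n)%N -> size (jacobi_poly J k) = k.+1.
Proof. by move=> lenN k lekn; rewrite size_jacobi_poly // (leq_trans lekn). Qed.

Let size_PC n : (n <= N)%N ->
  forall k, (k <= n)%N -> size (jacobi_poly (map_mx rc J) k) = k.+1.
Proof. by move=> lenN k lekn; rewrite jacobi_poly_map size_map_poly (size_P lenN). Qed.

Let coef_PC n : coef_mx (jacobi_poly (map_mx rc J)) n = map_mx rc (C n).
Proof. by apply/matrixP => i j; rewrite !mxE jacobi_poly_map coef_map. Qed.

(** The determinants alone do not give this: for [N = 1], the moments 1, i, -1 satisfy all the
    determinant conditions. *)
Lemma moment_gen_spectral_real l :
  (l <= 2 * N)%N -> moment Omega l \is Num.real.
Proof.
(* Splitting [l] as [i + j] with both at most [N] makes every moment an entry of the Hankel matrix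
   of index [N]. *)
move=> lel; pose i := minn l N; pose j := (l - i)%N.
have [ltiN ltjN] : (i < N.+1)%N /\ (j < N.+1)%N by rewrite /j /i; lia.
have -> : moment Omega l
    = hankel_mx (pairing Omega) N (Ordinal ltiN) (Ordinal ltjN).
  by rewrite mxE /= subnKC ?geq_minl.
rewrite (hankel_mxE _ (size_PC (leqnn N))) gram_mx_gen_spectral // coef_PC.
have -> : diag_mx (\row_(j < N.+1) (j < N)%:R)
    = map_mx rc (diag_mx (\row_(j < N.+1) (j < N)%:R)).
  by rewrite map_diag_mx; congr diag_mx; apply/rowP => k; rewrite !mxE rmorph_nat.
rewrite -map_invmx map_trmx -!map_mxM mxE.
by apply/complex_realP; eexists.
Qed.

Lemma hankel_det_gen_spectral n : (n <= N)%N ->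
  rc (\det (C n)) ^+ 2 * hankel_det Omega n = (n < N)%:R.
Proof.
move=> lenN; rewrite -det_map_mx -coef_PC -det_gram_mx; last exact: size_PC.
rewrite gram_mx_gen_spectral // det_diag big_ord_recr big1 /= ?mul1r ?mxE //.
by move=> i _; rewrite mxE /= (leq_trans (ltn_ord i)).
Qed.

Lemma hankel_det_gen_spectral_gt0 n : (n < N)%N -> 0 < hankel_det Omega n.
Proof.
move=> ltnN; have := hankel_det_gen_spectral (ltnW ltnN).
have d0 : \det (C n) != 0.
  by apply: det_coef_mx_neq0; apply: size_P; exact: ltnW.
(* In the order of [R[i]] positive elements are real; here the factor is the square of a nonzero
   real number. *)
have c_gt0 : 0 < rc (\det (C n)) ^+ 2.
  by rewrite -rmorphXn -[0]/(rc 0) ltcR exprn_even_gt0.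
by rewrite ltnN => eq1; rewrite -(pmulr_rgt0 _ c_gt0) eq1 ltr01.
Qed.

Lemma hankel_det_gen_spectral_eq0 : hankel_det Omega N = 0.
Proof.
have := hankel_det_gen_spectral (leqnn N); rewrite ltnn => /eqP.
rewrite mulf_eq0 expf_eq0 /= fmorph_eq0 => /orP[|/eqP //].
by rewrite (negPf (det_coef_mx_neq0 (size_P (leqnn N)))).
Qed.

End Necessity.

Lemma hankel_det0 (F : fieldType) (N : nat)
    (Omega : {scalar {poly_(2 * N).+1 F}}) : hankel_det Omega 0 = pairing Omega 1.
Proof. by rewrite /hankel_det det_mx11 mxE /moment expr0. Qed.

Unset Implicit Arguments.
Set Strict Implicit.

Theorem theorem8 (R : realType) (N : nat) (hN : (0 < N)%N)
    (Omega : {scalar {poly_(2 * N).+1 R[i]}}) :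
  (exists J : 'M[R]_N,
     is_jacobi J /\
     is_gen_spectral_function (map_mx (real_complex R) J) Omega)
  <->
  [/\ (forall l : nat, (l <= 2 * N)%N -> moment Omega l \is Num.real),
      hankel_det Omega 0 = 1,
      (forall n : nat, (1 <= n <= N.-1)%N -> 0 < hankel_det Omega n)
    & hankel_det Omega N = 0].
Proof.
split=> [[J [Jj specJ]]|[mreal D0 D_gt0 DN]].
  split=> [l||n /andP[_ lenN]|].
  - exact: (moment_gen_spectral_real Jj specJ).
  - by have [/(_ 0 0 hN hN)] := specJ; rewrite jacobi_poly0 mulr1 hankel_det0.
  - by apply: (hankel_det_gen_spectral_gt0 Jj specJ); rewrite -(prednK hN).
  - exact: (hankel_det_gen_spectral_eq0 Jj specJ).
(* With real moments the construction takes place over [R], and the determinant conditions pass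
   through the embedding into [R[i]], which is injective and reflects the order. *)
pose L : {scalar {poly R}} := real_pairing Omega.
have [|n /andP[n_gt0 ltnN]||J [Jj orth orthN]] := @favard_finite R L N hN.
- apply: (@complexI R); have := pairing_map mreal 1.
  by rewrite !rmorph1 -hankel_det0 D0 => ->.
- by rewrite -ltcR -hankel_det_map // D_gt0 // n_gt0 -ltnS prednK.
- by apply: (@complexI R); rewrite -hankel_det_map.
exists J; split=> //; split=> [m n ltmN ltnN|m lemN];
  rewrite !jacobi_poly_map -rmorphM pairing_map //.
  by rewrite [real_pairing _ _]orth // rmorph_nat.
by rewrite [real_pairing _ _]orthN // rmorph0.
Qed.
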